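(* Let $n\ge 1$ be an integer and let $a,b,c\in\mathbb{R}$ with $ac>0$. Put $s=\sqrt{ac}$ and $q=s/c$, and let $A_n=A_n(a,b,c)$. For $1\le k\le n$ define $$\theta_k=\frac{k\pi}{n+1},\qquad \lambda_k=b+2s\cos(\theta_k).$$ Then $\lambda_1,\dots,\lambda_n$ are the eigenvalues of $A_n$. Moreover, for each $1\le k\le n$, a right eigenvector $r^{(k)}\in\mathbb{R}^n$ of $A_n$ corresponding to $\lambda_k$ may be chosen with entries $$r^{(k)}_j=q^{j-1}\sin(j\theta_k),\qquad 1\le j\le n.$$
   Context: For $n\ge 1$ and $a,b,c\in\mathbb{R}$, $A_n(a,b,c)$ denotes the $n\times n$ tridiagonal Toeplitz matrix with all diagonal entries equal to $b$, all subdiagonal entries (positions $(i+1,i)$) equal to $a$, all superdiagonal entries (positions $(i,i+1)$) equal to $c$, and all other entries $0$. *)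

(* Defs.v *)
From HB Require Import structures.
From mathcomp Require Import all_boot all_order all_algebra.
From mathcomp Require Import all_classical all_reals all_analysis.

Set Implicit Arguments.
Unset Strict Implicit.
Unset Printing Implicit Defensive.

Import Order.TTheory GRing.Theory Num.Theory.
Local Open Scope ring_scope.

(* 'I_n is 0-based: the 1-based row (resp. column) i.+1 is row (resp. column) i
   here, so the subdiagonal entries, equal to a, are those with i = j + 1. *)
Definition tridiag_toeplitz (R : realType) (n : nat) (a b c : R) : 'M[R]_n :=
  \matrix_(i < n, j < n)
    if (i : nat) == j then b
    else if (i : nat) == j.+1 then a
    else if (j : nat) == i.+1 then c
    else 0.

Definition toeplitz_s (R : realType) (a c : R) : R := Num.sqrt (a * c).

Definition toeplitz_q (R : realType) (a c : R) : R := toeplitz_s a c / c.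

(* In the next three definitions k is the 1-based index, 1 <= k <= n. *)
Definition toeplitz_theta (R : realType) (n k : nat) : R :=
  k%:R * pi / n.+1%:R.

Definition toeplitz_lambda (R : realType) (n : nat) (a b c : R) (k : nat) : R :=
  b + 2 * toeplitz_s a c * cos (toeplitz_theta R n k).

(* The entry of 0-based index j is the 1-based entry j.+1, whence the exponent
   j and the angle j.+1 * theta. *)
Definition toeplitz_rvec (R : realType) (n : nat) (a c : R) (k : nat) :
    'cV[R]_n :=
  \col_(j < n)
    (toeplitz_q a c ^+ j * sin (j.+1%:R * toeplitz_theta R n k)).

(* MathComp's eigenspace consists of row vectors, i.e. left eigenvectors. *)
Definition right_eigenvector (R : realType) (n : nat) (A : 'M[R]_n) (l : R)
    (v : 'cV[R]_n) : Prop :=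
  v != 0 /\ A *m v = l *: v.

(* Main.v *)
Require Import Defs.
From HB Require Import structures.
From mathcomp Require Import all_boot all_order all_algebra.
From mathcomp Require Import all_classical all_reals all_analysis.
From mathcomp Require Import ring.

(** Extend a vector v_1, ..., v_n by boundary values v_0 = v_(n+1) = 0. Then
    A_n acts on it by the recurrence a v_(i-1) + b v_i + c v_(i+1), with no
    exceptional first or last row ([tridiag_toeplitz_mul_col]). Since
    a = q s and c q = s, the substitution v_j = q^(j-1) w_j turns this into the
    symmetric recurrence s w_(i-1) + b w_i + s w_(i+1), and the identity
    sin ((j-1) t) + sin ((j+1) t) = 2 cos t sin (j t) shows that
    w_j = sin (j t) satisfies it with eigenvalue b + 2 s cos t. The boundary
    value w_0 = 0 is automatic, and w_(n+1) = sin ((n+1) t) = 0 selects the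
    angles t = k pi / (n+1), which gives the right eigenvectors
    ([toeplitz_rvec_eigen]).

    The angles theta_1, ..., theta_n are distinct points of [0, pi], where cos
    is injective, and s is nonzero, so the lambda_k are pairwise distinct
    ([toeplitz_lambda_inj]). The characteristic polynomial is monic of degree n
    and has these n distinct roots, hence it is the product of the
    X - lambda_k, and there is no other eigenvalue. *)

Set Implicit Arguments.
Unset Strict Implicit.
Unset Printing Implicit Defensive.

Import Order.TTheory GRing.Theory Num.Theory.
Local Open Scope ring_scope.

(** A right eigenvector of A is a left eigenvector of its transpose; this
    lemma brings it back to [eigenvalue A], which speaks of row vectors. *)
Lemma eigenvalue_trmx (F : fieldType) (n : nat) (A : 'M[F]_n) (x : F) :
  eigenvalue A^T x = eigenvalue A x.
Proof.
rewrite /eigenvalue /eigenspace !kermx_eq0 /row_free.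
by rewrite -[in RHS]mxrank_tr linearB /= tr_scalar_mx.
Qed.

Lemma right_eigenvector_eigenvalue (R : realType) (n : nat) (A : 'M[R]_n)
    (x : R) (v : 'cV[R]_n) :
  right_eigenvector A x v -> eigenvalue A x.
Proof.
move=> [v_neq0 Av]; rewrite -eigenvalue_trmx; apply/eigenvalueP.
exists v^T; first by rewrite -trmx_mul Av linearZ.
by rewrite -(inj_eq trmx_inj) trmxK trmx0.
Qed.

Lemma char_poly_distinct_eigenvalues (F : fieldType) (n : nat) (A : 'M[F]_n)
    (xs : seq F) :
  size xs = n -> uniq xs -> all (eigenvalue A) xs ->
  char_poly A = \prod_(x <- xs) ('X - x%:P).
Proof.
move=> size_xs uniq_xs eig_xs.
rewrite [LHS](@all_roots_prod_XsubC _ _ xs).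
- by rewrite (monicP (char_poly_monic A)) scale1r.
- by rewrite size_char_poly size_xs.
- by apply: sub_all eig_xs => x; rewrite eigenvalue_root_char.
- by rewrite uniq_rootsE.
Qed.

Lemma sum_ord_pick (V : nmodType) (n m : nat) (F : nat -> V) :
  \sum_(j < n | (j : nat) == m) F j = if (m < n)%N then F m else 0.
Proof.
case: ltnP => [lt_mn | le_nm].
  by rewrite (big_pred1 (Ordinal lt_mn)).
by rewrite big_pred0 // => j; apply/negbTE; rewrite neq_ltn (leq_trans _ le_nm).
Qed.

(** The two boundary conditions stand for the entries missing from the first
    and the last row, so that all rows obey the same recurrence. *)
Lemma tridiag_toeplitz_mul_col (R : realType) (n : nat) (a b c : R)
    (g : nat -> R) :
  g 0%N = 0 -> g n.+1 = 0 ->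
  tridiag_toeplitz n a b c *m (\col_(j < n) g j.+1) =
  \col_(i < n) (a * g i + b * g i.+1 + c * g i.+2).
Proof.
move=> g0 gn; apply/colP => i; rewrite !mxE.
under eq_bigr => j _ do rewrite !mxE.
have split_entry (j : 'I_n) :
    (if (i : nat) == j then b else if (i : nat) == j.+1 then a
     else if (j : nat) == i.+1 then c else 0) * g j.+1 =
    (if (j.+1 == i)%N then a * g j.+1 else 0) +
    (if (j == i :> nat)%N then b * g j.+1 else 0) +
    (if (j == i.+1 :> nat)%N then c * g j.+1 else 0).
  rewrite [(i : nat) == j]eq_sym [(i : nat) == j.+1]eq_sym.
  case: (ltngtP (j : nat) i) => [lt_ji | lt_ij | ->].
  - rewrite [(j : nat) == i.+1]ltn_eqF ?(ltn_trans lt_ji) //.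
    by case: eqP => _; rewrite ?mul0r !addr0.
  - rewrite [j.+1 == i]gtn_eqF ?(ltn_trans lt_ij) //.
    by case: eqP => _; rewrite ?mul0r !add0r.
  - by rewrite gtn_eqF // ltn_eqF // add0r addr0.
under eq_bigr => j _ do rewrite split_entry.
rewrite !big_split /= -!big_mkcond /=.
rewrite (sum_ord_pick n i (fun j => b * g j.+1)).
rewrite (sum_ord_pick n i.+1 (fun j => c * g j.+1)) ltn_ord.
congr (_ + _ + _); last first.
  case: ltnP => // le_ni.
  by have -> : i.+1 = n; [apply/eqP; rewrite eqn_leq ltn_ord | rewrite gn mulr0].
case: i {split_entry} => -[|i] lt_in /=; first by rewrite big_pred0 ?g0 ?mulr0.
under eq_bigl => j do rewrite eqSS.
by rewrite (sum_ord_pick n i (fun j => a * g j.+1)) (ltn_trans _ lt_in).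
Qed.

Section SpectralData.

Variables (R : realType) (n : nat) (a b c : R).
Hypothesis ac_gt0 : 0 < a * c.

Lemma toeplitz_s_gt0 : 0 < toeplitz_s a c.
Proof. by rewrite sqrtr_gt0. Qed.

Let c_neq0 : c != 0.
Proof. by apply: contraTneq ac_gt0 => ->; rewrite mulr0 ltxx. Qed.

Lemma mul_toeplitz_q : c * toeplitz_q a c = toeplitz_s a c.
Proof. by rewrite /toeplitz_q mulrC divfK. Qed.

Lemma mul_toeplitz_qs : toeplitz_q a c * toeplitz_s a c = a.
Proof.
by rewrite /toeplitz_q mulrAC -expr2 sqr_sqrtr ?ltW // mulfK.
Qed.

Lemma sinB_sinD (x y : R) : sin (x - y) + sin (x + y) = 2 * cos y * sin x.
Proof. by rewrite sinB sinD; ring. Qed.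

Lemma sin_natpi (k : nat) : sin (k%:R * pi : R) = 0.
Proof.
elim: k => [|k IHk]; first by rewrite mul0r sin0.
by rewrite -natr1 mulrDl mul1r sinDpi IHk oppr0.
Qed.

Lemma toeplitz_theta_itv (k : nat) :
  (1 <= k <= n)%N -> 0 < toeplitz_theta R n k < pi.
Proof.
move=> /andP[k_gt0 le_kn]; rewrite /toeplitz_theta.
rewrite divr_gt0 ?mulr_gt0 ?pi_gt0 ?ltr0n //=.
by rewrite ltr_pdivrMr ?ltr0n // mulrC ltr_pM2l ?pi_gt0 // ltr_nat.
Qed.

Lemma toeplitz_theta_inj : injective (toeplitz_theta R n).
Proof.
move=> k l; rewrite /toeplitz_theta => /mulIf.
rewrite invr_eq0 pnatr_eq0 => /(_ isT) /mulIf.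
by rewrite gt_eqF ?pi_gt0 // => /(_ isT) /eqP; rewrite eqr_nat => /eqP.
Qed.

Lemma toeplitz_lambda_inj :
  {in [pred k | (1 <= k <= n)%N] &, injective (toeplitz_lambda n a b c)}.
Proof.
move=> k l k_itv l_itv /addrI /mulfI.
rewrite mulf_neq0 ?pnatr_eq0 ?gt_eqF ?toeplitz_s_gt0 // => /(_ isT) cos_eq.
apply: toeplitz_theta_inj; apply: cos_inj cos_eq; rewrite in_itv /=.
  by have /andP[/ltW -> /ltW ->] := toeplitz_theta_itv k_itv.
by have /andP[/ltW -> /ltW ->] := toeplitz_theta_itv l_itv.
Qed.

(** The choice of theta_k enters only through sin ((n+1) theta_k) = sin (k pi)
    = 0, the right boundary condition; the left one is sin 0 = 0. *)
Lemma toeplitz_rvec_eigen (k : nat) :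
  tridiag_toeplitz n a b c *m toeplitz_rvec n a c k =
  toeplitz_lambda n a b c k *: toeplitz_rvec n a c k.
Proof.
set t := toeplitz_theta R n k; set q := toeplitz_q a c.
(* At index 0 the truncated exponent is harmless, because sin 0 = 0. *)
pose g (j : nat) : R := q ^+ j.-1 * sin (j%:R * t).
have g0 : g 0%N = 0 by rewrite /g mul0r sin0 mulr0.
have gn : g n.+1 = 0.
  rewrite /g /t /toeplitz_theta [n.+1%:R * _]mulrC divfK ?pnatr_eq0 //.
  by rewrite sin_natpi mulr0.
have -> : toeplitz_rvec n a c k = \col_(j < n) g j.+1 by [].
rewrite tridiag_toeplitz_mul_col //; apply/colP => i; rewrite !mxE.
have sub_entry : a * g i = q ^+ i * toeplitz_s a c * sin (i%:R * t).
  case: (i : nat) => [|j]; first by rewrite g0 mul0r sin0 !mulr0.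
  by rewrite /g /= -{1}mul_toeplitz_qs exprS -/q; ring.
have super_entry : c * g i.+2 = q ^+ i * toeplitz_s a c * sin (i.+2%:R * t).
  by rewrite /g /= -mul_toeplitz_q exprS -/q; ring.
have sum_sin : sin (i%:R * t) + sin (i.+2%:R * t) =
    2 * cos t * sin (i.+1%:R * t).
  rewrite -sinB_sinD -[i.+2%:R]natr1 -[i.+1%:R]natr1.
  by congr (sin _ + sin _); ring.
rewrite sub_entry super_entry addrAC -mulrDr sum_sin /g /= /toeplitz_lambda -/t.
by ring.
Qed.

Lemma toeplitz_rvec_right_eigenvector (k : nat) :
  (1 <= k <= n)%N ->
  right_eigenvector (tridiag_toeplitz n a b c) (toeplitz_lambda n a b c k)
    (toeplitz_rvec n a c k).
Proof.
move=> k_itv; split; last exact: toeplitz_rvec_eigen.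
have n_gt0 : (0 < n)%N by case/andP: k_itv => /leq_trans; apply.
(* The first entry is sin theta_k, with theta_k strictly between 0 and pi. *)
apply/eqP => /colP /(_ (Ordinal n_gt0)) /eqP; apply/negP.
by rewrite !mxE expr0 !mul1r gt_eqF // sin_gt0_pi // toeplitz_theta_itv.
Qed.

Lemma char_poly_tridiag_toeplitz :
  char_poly (tridiag_toeplitz n a b c) =
  \prod_(1 <= k < n.+1) ('X - (toeplitz_lambda n a b c k)%:P).
Proof.
rewrite (@char_poly_distinct_eigenvalues _ _ _
  [seq toeplitz_lambda n a b c k | k <- index_iota 1 n.+1]).
- by rewrite big_map.
- by rewrite size_map size_iota subSS subn0.
- rewrite map_inj_in_uniq ?iota_uniq // => k l.
  rewrite !mem_index_iota !ltnS; exact: toeplitz_lambda_inj.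
- apply/allP => _ /mapP[k k_itv ->].
  apply: right_eigenvector_eigenvalue (toeplitz_rvec_right_eigenvector _).
  by move: k_itv; rewrite mem_index_iota ltnS.
Qed.

Lemma eigenvalue_tridiag_toeplitz (x : R) :
  eigenvalue (tridiag_toeplitz n a b c) x <->
  exists2 k : nat, (1 <= k <= n)%N & x = toeplitz_lambda n a b c k.
Proof.
rewrite eigenvalue_root_char char_poly_tridiag_toeplitz.
rewrite -(big_map (toeplitz_lambda n a b c) xpredT (fun y => 'X - y%:P)).
rewrite root_prod_XsubC; split.
  by move=> /mapP[k] k_itv ->; exists k; rewrite // mem_index_iota ltnS in k_itv.
by move=> [k k_itv ->]; apply: map_f; rewrite mem_index_iota ltnS.
Qed.

End SpectralData.

Theorem theorem3p2 (R : realType) (n : nat) (a b c : R)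
    (hn : (1 <= n)%N) (hac : 0 < a * c) :
  [/\ (forall x : R,
         eigenvalue (tridiag_toeplitz n a b c) x <->
         exists2 k : nat, (1 <= k <= n)%N & x = toeplitz_lambda n a b c k),
      char_poly (tridiag_toeplitz n a b c) =
        \prod_(1 <= k < n.+1) ('X - (toeplitz_lambda n a b c k)%:P)
    & (forall k : nat, (1 <= k <= n)%N ->
         right_eigenvector (tridiag_toeplitz n a b c)
           (toeplitz_lambda n a b c k) (toeplitz_rvec n a c k))].
Proof.
split.
- exact: eigenvalue_tridiag_toeplitz.
- exact: char_poly_tridiag_toeplitz.
- exact: toeplitz_rvec_right_eigenvector.
Qed.
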